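(* Let $G$ be a countable infinite group. Then for every $k\in\mathbb N$ the group $G$ admits a partition $G=A\cup B$ into two $k$-meager subsets.
   Context: $\mathbb N=\{1,2,3,\dots\}$. The group $G$ is considered as a $G$-space with the action of $G$ on itself by left multiplication. For $F,A\subset G$ put $FA=\{fa:f\in F,\ a\in A\}$. A subset $A\subset G$ is called thick if for each finite subset $F\subset G$ there is a point $x\in G$ with $Fx\subset A$. For $k\in\mathbb N$, a subset $A\subset G$ is called $k$-meager if $KA$ is not thick for any subset $K\subset G$ of cardinality $|K|\le k$. *)

(* Defs.v *)
From mathcomp Require Import all_boot.
From mathcomp Require Import boolp classical_sets functions cardinality.

Set Implicit Arguments.
Unset Strict Implicit.
Unset Printing Implicit Defensive.

Local Open Scope classical_set_scope.

Definition set_prod (G : groupType) (F A : set G) : set G :=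
  [set (f * a)%g | f in F & a in A].

Definition thick (G : groupType) (A : set G) : Prop :=
  forall F : set G, finite_set F -> exists x : G, set_prod F [set x] `<=` A.

(* |K| <= k is K #<= `I_k, where `I_k is the k-element set {0, ..., k - 1};
   in particular such a K is finite. *)
Definition meager (G : groupType) (k : nat) (A : set G) : Prop :=
  forall K : set G, (K #<= `I_k)%card -> ~ thick (set_prod K A).

(* Main.v *)
(** A set A is k-meager iff for every K with |K| <= k the set of y with Ky
    disjoint from A is syndetic, so it suffices to 2-color G such that for every
    such K and every color the translates Ky of that color occur syndetically.
    Choose a finite F_n for the n-th set K_n with the sets K_n f (f in F_n)
    pairwise disjoint, and require that for every x and every color some
    K_n f x has that color. A random coloring violates one such constraint
    with probability at most (1 - 2^-k)^|F_n|, which is exponentially small in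
    the size k|F_n| of its support because k is fixed; hence, for suitably large
    F_n, a local lemma handles finitely many constraints at once, and a limit
    along an ultrafilter handles all of them. *)

Require Import Defs.
From mathcomp Require Import all_boot all_order all_algebra ring lra.
From mathcomp Require Import boolp classical_sets functions cardinality filter.

Set Implicit Arguments.
Unset Strict Implicit.
Unset Printing Implicit Defensive.

Import Order.TTheory GRing.Theory Num.Theory.

(** * Counting colorings of a finite set, and a local lemma for them *)

Section Counting.
Variable T : finType.
Local Notation coloring := {ffun T -> bool}.
Implicit Types (P Q : pred coloring) (D : seq T) (Bs : seq (seq T)).

(** Counting form of independence: under a uniformly random coloring, the event [Q] is independent
    of the colors on [D]. *)
Definition ignores Q D :=
  forall c c' : coloring, {in [predC D], c =1 c'} -> Q c = Q c'.

Lemma ignores_sub Q D D' : {subset D' <= D} -> ignores Q D -> ignores Q D'.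
Proof.
move=> sD QD c c' cc'; apply: QD => u; rewrite inE => uD.
by apply: cc'; rewrite inE; apply: contra uD => /sD.
Qed.

(** Flipping the color of [v] is an involution that preserves [Q] and exchanges the two possible
    colors of [v]. *)
Lemma card_ignores1 Q v a : ignores Q [:: v] ->
  (#|[pred c : coloring | Q c && (c v == a)]| * 2)%N = #|Q|.
Proof.
move=> Qv.
pose flip (c : coloring) : coloring := [ffun u => c u (+) (u == v)].
have flipK : involutive flip.
  by move=> c; apply/ffunP => u; rewrite !ffunE -addbA addbb addbF.
rewrite -(cardID [pred c : coloring | c v == a] Q) muln2 -addnn; congr (_ + _)%N.
rewrite -(fintype.card_image (inv_inj flipK)); apply: eq_card => c.
apply/fintype.imageP/idP => [[d]|].
  rewrite !inE => /andP[Qd /eqP dv] ->; rewrite !ffunE eqxx dv addbT.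
  rewrite (_ : (_ == _) = false) /=; last by case: (a).
  rewrite unfold_in (Qv _ d) // => u; rewrite !inE ffunE => /negbTE ->.
  by rewrite addbF.
rewrite !inE => /andP[cv Qc]; exists (flip c); last by rewrite flipK.
rewrite !inE !ffunE eqxx addbT.
rewrite (Qv _ c) => [|u]; last by rewrite !inE ffunE => /negbTE ->; rewrite addbF.
by rewrite -[Q c]/(c \in Q) Qc; move: cv => /=; case: (c v) (a) => [] [].
Qed.

Lemma card_ignores_mono Q D a : uniq D -> ignores Q D ->
  (#|[pred c : coloring | Q c && all (fun v => c v == a) D]| * 2 ^ size D)%N
  = #|Q|.
Proof.
elim: D Q => [|v D IH] Q /=.
  by move=> _ _; rewrite muln1; apply: eq_card => c; rewrite !inE andbT.
case/andP=> vD uD QD.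
have <- : (#|[pred c : coloring | Q c && (c v == a)]| * 2)%N = #|Q|.
  by apply: card_ignores1; apply: ignores_sub QD => u; rewrite !inE => ->.
have /(IH _ uD) <- : ignores [pred c : coloring | Q c && (c v == a)] D.
  move=> c c' cc' /=; rewrite cc' ?inE //; congr (_ && _).
  by apply: QD => u; rewrite !inE negb_or => /andP[_ uD']; apply: cc'.
rewrite expnS mulnA mulnAC; congr (_ * _ * _)%N.
by apply: eq_card => c; rewrite !inE /= andbA.
Qed.

Local Open Scope ring_scope.
Variable R : realFieldType.

(** Disjoint blocks are colored independently of each other and of [Q], and each one misses being
    monochromatic of color [a] with probability at most [1 - 2 ^- k]. The induction moves the
    failure of the first block into [Q], which still ignores the remaining blocks. *)
Lemma card_ignores_no_mono Q Bs a (k : nat) :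
  uniq (flatten Bs) -> (forall D, D \in Bs -> (size D <= k)%N) ->
  ignores Q (flatten Bs) ->
  #|[pred c : coloring | Q c && ~~ has (all (fun v => c v == a)) Bs]|%:R
  <= (1 - 2 ^- k) ^+ size Bs * #|Q|%:R :> R.
Proof.
elim: Bs Q => [|D Bs IH] Q /=.
  move=> _ _ _; rewrite mul1r ler_nat; apply: subset_leq_card.
  by apply/fintype.subsetP => c; rewrite !inE => /andP[].
rewrite cat_uniq => /and3P[uD /hasPn DBs uBs] sz QD.
pose Q' := [pred c : coloring | Q c && ~~ all (fun v => c v == a) D].
have sub2 : {subset flatten Bs <= D ++ flatten Bs}.
  by move=> u uB; rewrite mem_cat uB orbT.
have szB D' : D' \in Bs -> (size D' <= k)%N by move=> D'B; rewrite sz // inE D'B orbT.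
have QB : ignores Q' (flatten Bs).
  move=> c c' cc'; congr (_ && ~~ _); first exact: (ignores_sub sub2 QD).
  apply: eq_in_all => u uD'; rewrite cc' // inE.
  by apply/negP => /DBs /=; rewrite uD'.
have IH' := IH Q' uBs szB QB.
apply: (@le_trans _ _ #|[pred c : coloring |
    Q' c && ~~ has (all (fun v => c v == a)) Bs]|%:R).
  rewrite ler_nat; apply: subset_leq_card; apply/fintype.subsetP => c.
  by rewrite !inE /= negb_or andbA.
apply: le_trans IH' _.
have q0 : 0 <= 1 - 2 ^- k :> R by rewrite subr_ge0 invf_le1 ?exprn_ege1 ?exprn_gt0 ?ler1n.
rewrite exprSr -mulrA ler_wpM2l ?exprn_ge0 //.
have /(card_ignores_mono a uD) Dcard : ignores Q D.
  by apply: ignores_sub QD => u uD'; rewrite mem_cat uD'.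
set x := #|_| in Dcard.
have Qx : #|Q| = (x + #|Q'|)%N.
  rewrite -(cardID [pred c : coloring | all (fun v => c v == a) D] Q).
  by congr (_ + _)%N; apply: eq_card => c; rewrite !inE ?andbT // andbC.
(* The exact proportion is [2 ^- size D], so a block shorter than [k] only helps. *)
have xge : 2 ^- k * #|Q|%:R <= x%:R :> R.
  rewrite ler_pdivrMl ?exprn_gt0 // -Dcard natrM natrX mulrC.
  by rewrite ler_wpM2r // ler_weXn2l ?ler1n // sz // inE eqxx.
by rewrite mulrBl mul1r; move: xge; rewrite [in X in _ -> _ <= X - _]Qx natrD; lra.
Qed.

(* Rosenfeld's counting argument: enlarging [V] by one point keeps at least the
   fraction [al] of the colorings satisfying all constraints supported in [V]. *)
Lemma avoiding_coloring (I : finType) (E : pred I) (bl : I -> seq (seq T))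
    (col : I -> bool) (k : nat) (al r : R) :
  (forall i, E i -> uniq (flatten (bl i))) ->
  (forall i, E i -> (0 < size (bl i))%N) ->
  (forall i D, E i -> D \in bl i -> (size D <= k)%N) ->
  0 < al <= 1 -> 0 <= r -> 1 - 2 ^- k <= r * al ^+ k ->
  (forall v, \sum_(i | E i && (v \in flatten (bl i))) r ^+ size (bl i)
     <= 1 - al) ->
  exists c : coloring,
    forall i, E i -> has (all (fun v => c v == col i)) (bl i).
Proof.
move=> bl_uniq bl_gt0 bl_size /andP[al0 al1] r0 qr hsum.
pose S i : {set T} := [set v in flatten (bl i)]%SET.
pose bad i (c : coloring) := ~~ has (all (fun v => c v == col i)) (bl i).
pose good (V : {set T}) (c : coloring) :=
  [forall i, E i && (S i \subset V) ==> ~~ bad i c].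
pose g V := #|good V|.
have good_ign (V W : {set T}) D : [disjoint V & D] -> W \subset V -> ignores (good W) D.
  move=> dVD WV c c' cc'; apply: eq_forallb => i; case: (boolP (_ && _)) => //=.
  case/andP=> _ SW; rewrite !negbK; apply: eq_in_has => B BB.
  apply: eq_in_all => u uB; rewrite cc' // inE; apply/negP => uD.
  move/pred0P: dVD => /(_ u) /=; rewrite uD andbT => /negP[].
  apply: (fintype.subsetP WV); apply: (fintype.subsetP SW); rewrite inE.
  by apply/flattenP; exists B.
have S_size i : E i -> (#|S i| <= k * size (bl i))%N.
  move=> Ei; rewrite cardsE; apply: leq_trans (card_size _) _.
  have := fun D => @bl_size i D Ei.
  elim: (bl i) => [//|D Bs IH] /= sz.
  rewrite size_cat mulnS leq_add ?sz ?inE ?eqxx // IH // => D' D'B.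
  by rewrite sz // inE D'B orbT.
(* The bound is stated for all nested pairs, because the induction also has to compare [V'] with
   [V' :\: S i], many points at once. *)
have key m : forall V W : {set T}, (#|V| <= m)%N -> W \subset V ->
    al ^+ #|V :\: W| * (g W)%:R <= (g V)%:R.
  elim: m => [|m IH] V W Vm WV.
    have -> : W = V.
      move: Vm; rewrite leqn0 cards_eq0 => /eqP V0; apply/eqP.
      by rewrite finset.eqEsubset WV V0 finset.sub0set.
    by rewrite finset.setDv cards0 mul1r.
  have [->|WnV] := eqVneq W V; first by rewrite finset.setDv cards0 mul1r.
  have /properP[_ [v vV vW]] : W \proper V by rewrite finset.properEneq WnV.
  have V'm : (#|V :\ v| <= m)%N by move: Vm; rewrite (cardsD1 v) vV.
  have WV' : W \subset V :\ v by rewrite finset.subsetD1 WV.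
  have -> : #|V :\: W| = #|(V :\ v) :\: W|.+1.
    rewrite (cardsD1 v) !inE vV vW; congr _.+1; apply: eq_card => u.
    by rewrite !inE; case: (u == v); rewrite ?andbF.
  rewrite exprS -mulrA.
  apply: (@le_trans _ _ (al * (g (V :\ v))%:R)).
    by rewrite ler_wpM2l ?(ltW al0) // IH.
  set V' := V :\ v in V'm WV' *.
  pose J := [pred i | E i && (v \in flatten (bl i))].
  (* A coloring good for [V'] but not for [V] violates some constraint [i] supported in [V]. The
     support must contain [v], since otherwise it would lie in [V']. *)
  have split : (g V' <= g V + \sum_(i | J i) #|[predI good (V' :\: S i) & bad i]|)%N.
    rewrite /g -(cardID (good V) (good V')) leq_add //.
      by apply: subset_leq_card; apply/fintype.subsetP => c; rewrite !inE => /andP[].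
    rewrite -!sum1_card.
    under [X in (_ <= X)%N]eq_bigr do rewrite -sum1_card.
    rewrite (exchange_big_dep predT) //= [X in (X <= _)%N]big_mkcond.
    apply: leq_sum => c _; case: ifP => // /[!inE] /andP[/forallPn[i]].
    rewrite negb_imply negbK => /andP[/andP[Ei SV] badi] gV'.
    rewrite sum1_card; apply/card_gt0P; exists i; rewrite unfold_in /=.
    rewrite Ei /=; apply/andP; split; last (apply/andP; split; [|exact: badi]).
      apply/negPn/negP => vS; move: gV' => /forallP /(_ i).
      rewrite Ei badi /= implybF; case/negP.
      by rewrite finset.subsetD1 SV inE vS.
    apply/forallP => j; apply/implyP => /andP[Ej SjV].
    move: gV' => /forallP /(_ j); rewrite Ej /= => /implyP; apply.
    by apply: fintype.subset_trans SjV _; exact: finset.subsetDl.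
  (* Being good for [V' :\: S i] ignores the support of [i], so independence costs a factor
     [(1 - 2 ^- k) ^+ size (bl i)]. This is at most [r ^+ size (bl i) * al ^+ #|S i|], and the power
     of [al] pays, by the induction hypothesis, for returning from [V' :\: S i] to [V']. *)
  have each i : J i -> #|[predI good (V' :\: S i) & bad i]|%:R
      <= r ^+ size (bl i) * (g V')%:R :> R.
    case/andP=> Ei vSi.
    have ign : ignores (good (V' :\: S i)) (flatten (bl i)).
      apply: (@good_ign (V' :\: S i)) => //.
      by apply/pred0P => u; rewrite !inE /=; case: (u \in flatten _); rewrite ?andbF.
    have sz D : D \in bl i -> (size D <= k)%N := @bl_size i D Ei.
    have H := card_ignores_no_mono (col i) (bl_uniq i Ei) sz ign.
    apply: le_trans H _.
    have qn : (1 - 2 ^- k) ^+ size (bl i) <= r ^+ size (bl i) * al ^+ #|S i|.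
      apply: (@le_trans _ _ ((r * al ^+ k) ^+ size (bl i))).
        rewrite lerXn2r // ?nnegrE ?mulr_ge0 ?exprn_ge0 ?(ltW al0) //.
        by rewrite subr_ge0 invf_le1 ?exprn_ege1 ?exprn_gt0 ?ler1n.
      rewrite exprMn -exprM ler_wpM2l ?exprn_ge0 // ler_wiXn2l ?(ltW al0) //.
      exact: S_size.
    apply: le_trans (ler_wpM2r _ qn) _; first exact: ler0n.
    rewrite -mulrA ler_wpM2l ?exprn_ge0 //.
    apply: le_trans (IH V' (V' :\: S i) V'm (finset.subsetDl _ _)).
    rewrite ler_wpM2r ?ler0n // ler_wiXn2l ?(ltW al0) //.
    apply: subset_leq_card; rewrite finset.setDDr finset.setDv finset.set0U; exact: finset.subsetIr.
  have : (g V')%:R <= (g V)%:R + (1 - al) * (g V')%:R :> R.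
    apply: le_trans (_ : _ <= (g V)%:R + \sum_(i | J i) (r ^+ size (bl i) * (g V')%:R)) _.
      move: split; rewrite -(ler_nat R) natrD natr_sum => /le_trans; apply.
      by rewrite lerD2l; apply: ler_sum.
    by rewrite lerD2l -mulr_suml ler_wpM2r ?ler0n // hsum.
  by rewrite mulrBl mul1r; lra.
(* A constraint with empty support has an empty first block, which is vacuously monochromatic; so
   every coloring is good for the empty set. *)
have g0 : (0 < g finset.set0)%N.
  apply/card_gt0P; exists [ffun=> true]; apply/forallP => i; apply/implyP.
  case/andP=> Ei; rewrite finset.subset0 negbK => /eqP S0.
  have := bl_gt0 i Ei; case Ebl: (bl i) => [//|D Bs] _ /=.
  suff -> : D = [::] by [].
  case: D Ebl => [//|v D] Ebl; have : v \in S i by rewrite inE Ebl /= inE eqxx.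
  by rewrite S0 inE.
have : 0 < (g [set: T]%SET)%:R :> R.
  apply: lt_le_trans (key #|T| _ finset.set0 _ (finset.sub0set _)); last by rewrite max_card.
  by rewrite mulr_gt0 ?exprn_gt0 // ltr0n.
rewrite ltr0n => /card_gt0P[c /forallP gc]; exists c => i Ei.
by move: (gc i); rewrite Ei finset.subsetT negbK.
Qed.

End Counting.

(** * Numerical constants for the local lemma *)

Section Bounds.
Local Open Scope ring_scope.

Lemma bernoulli_ineq (R : realDomainType) (x : R) n :
  -1 <= x -> 1 + n%:R * x <= (1 + x) ^+ n.
Proof.
move=> x1; elim: n => [|n IH]; first by rewrite mul0r addr0.
have x0 : 0 <= 1 + x by lra.
rewrite exprS; apply: le_trans (ler_wpM2l x0 IH).
have := mulr_ge0 (ler0n R n) (sqr_ge0 x); rewrite -natr1; lra.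
Qed.

(** With [t = 1 - r], one has [r * (1 + t) <= 1], so Bernoulli gives [r ^+ m <= 1 / (m * t)].
    Squaring yields the bound [2 / (m * t ^+ 2)] for [N = 2 * m], and [m] is chosen to make this at
    most [eps]. *)
Lemma mulrn_expr_small (r eps : rat) : 0 <= r < 1 -> 0 < eps ->
  exists2 N : nat, (0 < N)%N & N%:R * r ^+ N <= eps.
Proof.
move=> /andP[r0 r1] eps0; pose t := 1 - r.
have t0 : 0 < t by rewrite subr_gt0.
pose m := (Num.bound (2 / (t ^+ 2 * eps))).+1.
have mbig : 2 <= m%:R * (t ^+ 2 * eps).
  rewrite -ler_pdivrMr ?mulr_gt0 ?exprn_gt0 //.
  apply: le_trans (ltW (archi_boundP _)) _.
    by rewrite divr_ge0 // mulr_ge0 ?exprn_ge0 // ltW.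
  by rewrite ler_nat.
have rm : r ^+ m * (m%:R * t) <= 1.
  apply: (@le_trans _ _ ((r * (1 + t)) ^+ m)).
    rewrite exprMn ler_wpM2l ?exprn_ge0 //.
    by apply: le_trans (bernoulli_ineq m _); rewrite /t; lra.
  by rewrite exprn_ile1 // /t; nra.
exists (m * 2)%N => //.
have m0 : 0 < m%:R :> rat by rewrite ltr0n.
have := exprn_ge0 m r0; rewrite exprM natrM.
move: (r ^+ m) rm => u um u0.
have mt0 : 0 < m%:R * t by rewrite mulr_gt0.
have u2 : (u * (m%:R * t)) ^+ 2 <= 1 by rewrite exprn_ile1 ?mulr_ge0 // ltW.
rewrite -(ler_pM2r (mulr_gt0 m0 (exprn_gt0 2 t0))).
apply: (@le_trans _ _ (2 * (u * (m%:R * t)) ^+ 2)).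
  by rewrite le_eqVlt; apply/orP; left; apply/eqP; ring.
apply: le_trans (_ : _ <= 2) _; first by rewrite -[leRHS]mulr1 ler_wpM2l.
by rewrite (_ : eps * _ = m%:R * (t ^+ 2 * eps)) //; ring.
Qed.

Lemma sum_half_pow_le1 (R : realFieldType) M :
  \sum_(n < M) 2 ^- n.+1 <= 1 :> R.
Proof.
suff -> : \sum_(n < M) 2 ^- n.+1 = 1 - 2 ^- M :> R.
  by rewrite gerBl invr_ge0 exprn_ge0.
elim: M => [|M IH]; first by rewrite big_ord0 expr0 invr1 subrr.
rewrite big_ord_recr /= IH exprS invfM; lra.
Qed.

(** Take [al = 1 - d] with [(k + 1) * d = 2 ^- k]. Bernoulli gives
    [al ^+ k >= 1 - k * d > 1 - 2 ^- k], so the quotient [r] of [1 - 2 ^- k] by [al ^+ k] is below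
    1. *)
Lemma local_lemma_constants k : (0 < k)%N -> exists al r : rat,
  [/\ 0 < al < 1, 0 <= r < 1 & 1 - 2 ^- k <= r * al ^+ k].
Proof.
move=> k_gt0; pose d : rat := 2 ^- k / k.+1%:R.
have p0 : 0 < 2 ^- k :> rat by rewrite invr_gt0 exprn_gt0.
have p1 : 2 ^- k <= 1 :> rat by rewrite invf_le1 ?exprn_gt0 ?exprn_ege1.
have d0 : 0 < d by rewrite divr_gt0.
have dk : k.+1%:R * d = 2 ^- k by rewrite mulrC divfK // pnatr_eq0.
have kd : 0 <= k%:R * d by rewrite mulr_ge0 // ltW.
move: dk; rewrite -natr1 mulrDl mul1r => dk.
have kd1 : d <= k%:R * d by rewrite ler_peMl ?ler1n // ltW.
have al0 : 0 < 1 - d by lra.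
have := @bernoulli_ineq _ (- d) k; rewrite mulrN => bern.
have alk : 1 - 2 ^- k < (1 - d) ^+ k by apply: lt_le_trans (bern _); lra.
exists (1 - d), ((1 - 2 ^- k) / (1 - d) ^+ k); split.
- by lra.
- by rewrite divr_ge0 ?subr_ge0 ?exprn_ge0 ?(ltW al0) // ltr_pdivrMr ?exprn_gt0 // mul1r.
- by rewrite divfK // gt_eqF // exprn_gt0.
Qed.

End Bounds.

(** * Colorings of an infinite group: finite stages and their limit *)

Section Group.
Variable G : groupType.
Hypothesis infiniteG : infinite_set [set: G]%classic.
Local Open Scope group_scope.

Definition translates (K F : seq G) := [seq [seq h * f | h <- K] | f <- F].

(** A new translate of [K] by [f] meets the earlier ones only if [f] lies in the finite set [U] of
    products of an inverse from [K] with an earlier point; an infinite group has an [f] outside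
    [U]. *)
Lemma disjoint_translates (K : seq G) N : uniq K ->
  exists2 F : seq G, size F = N & uniq (flatten (translates K F)).
Proof.
move=> uK; elim: N => [|N [F FN uF]]; first by exists [::].
pose U := [seq h^-1 * u | h <- K, u <- flatten (translates K F)].
have [f fU] : exists f, f \notin U.
  apply: contrapT => /forallNP all_U; apply: infiniteG.
  by apply/finite_seqP; exists U; apply/seteqP; split=> f //= _; apply/negPn/negP/all_U.
exists (f :: F); first by rewrite /= FN.
rewrite /= cat_uniq uF andbT map_inj_uniq ?uK; last exact: mulIg.
apply/hasPn => u uU; apply/mapP => -[h hK uhf]; move/negP: fU; apply.
by apply/allpairsP; exists (h, u); split => //=; rewrite uhf mulKg.
Qed.

Definition shifted_translates (K F : seq G) x :=
  [seq [seq h * x | h <- D] | D <- translates K F].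

Local Open Scope ring_scope.

Lemma size_flatten_translates (K F : seq G) :
  size (flatten (translates K F)) = (size F * size K)%N.
Proof.
by elim: F => [//|f F IH]; rewrite /= size_cat size_map IH mulSn.
Qed.

(** The local lemma on the points numbered at most [M], with only the constraints that fit there.
    Level [n] may use the share [(1 - al) * 2 ^- n.+1] of the total weight [1 - al] at each point,
    so the hypotheses on [K] and [F] do not depend on [M]. *)
Lemma finite_stage_coloring (k : nat) (al r : rat) (K F : nat -> seq G)
    (e : G -> nat) (d : nat -> G) (M : nat) :
  cancel e d -> 0 < al <= 1 -> 0 <= r -> 1 - 2 ^- k <= r * al ^+ k ->
  (forall n, size (K n) <= k)%N -> (forall n, 0 < size (F n))%N ->
  (forall n, uniq (flatten (translates (K n) (F n)))) ->
  (forall n,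
     (size (F n) * k * 2)%:R * r ^+ size (F n) <= (1 - al) * 2 ^- n.+1) ->
  exists c : G -> bool, forall n a x, (n < M)%N -> (e x <= M)%N ->
    all (fun g => e g <= M)%N (flatten (shifted_translates (K n) (F n) x)) ->
    has (all (fun g => c g == a)) (shifted_translates (K n) (F n) x).
Proof.
move=> eK al01 r0 qr Kk F0 uKF KFr.
pose t g : 'I_M.+1 := inord (e g).
have tK g : (e g <= M)%N -> d (t g) = g by move=> gM; rewrite inordK.
pose I := ('I_M * 'I_M.+1 * bool)%type.
pose B n x := shifted_translates (K n) (F n) x.
pose bl (i : I) := [seq [seq t g | g <- D] | D <- B i.1.1 (d i.1.2)].
(* The first conjunct makes the index a function of the center [d i.1.2], as [d] need not be
   injective. The second keeps the blocks where [t] is injective, away from the default value of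
   [inord]. *)
pose E (i : I) := (t (d i.1.2) == i.1.2) &&
  all (fun g => e g <= M)%N (flatten (B i.1.1 (d i.1.2))).
have flattenB n x : flatten (B n x)
    = [seq g * x | g <- flatten (translates (K n) (F n))]%g.
  by rewrite -map_flatten.
have size_bl i : size (bl i) = size (F i.1.1) by rewrite !size_map.
have bl_uniq i : E i -> uniq (flatten (bl i)).
  move=> /andP[_ /allP BM]; rewrite /bl -map_flatten map_inj_in_uniq.
    by rewrite flattenB map_inj_uniq //; exact: mulIg.
  by move=> g h /BM gM /BM hM tgh; rewrite -(tK g) // tgh tK.
have bl_gt0 i : E i -> (0 < size (bl i))%N by rewrite size_bl.
have bl_size i D : E i -> D \in bl i -> (size D <= k)%N.
  by move=> _ /mapP[_ /mapP[_ /mapP[f _ ->] ->] ->]; rewrite !size_map.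
have sum_bl v : \sum_(i | E i && (v \in flatten (bl i))) r ^+ size (bl i)
    <= 1 - al.
  have al1 : 0 <= 1 - al by rewrite subr_ge0; case/andP: al01.
  rewrite (partition_big (fun i : I => i.1.1) predT) //=.
  apply: (@le_trans _ _ (\sum_(n < M) (1 - al) * 2 ^- n.+1)); last first.
    by rewrite -mulr_sumr ler_piMr // sum_half_pow_le1.
  apply: ler_sum => n _; apply: le_trans (KFr n).
  rewrite (eq_bigr (fun=> r ^+ size (F n))); last first.
    by move=> i /andP[_ /eqP <-]; rewrite size_bl.
  rewrite big_const iter_addr_0 -[leLHS]mulr_natl ler_wpM2r ?exprn_ge0 // ler_nat.
  (* If [v] encodes [g * x], then [g] and [v] determine the center [x]; hence at most
     [size (F n) * k * 2] constraints of level [n] pass through [v], the 2 counting colors. *)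
  pose s := [seq (n, t (g^-1 * d v)%g, a) |
    g <- flatten (translates (K n) (F n)), a <- [:: true; false]].
  apply: (@leq_trans #|s|).
    apply: subset_leq_card; apply/fintype.subsetP => -[[n' o] a].
    rewrite unfold_in /= => /andP[/andP[/andP[/= /eqP to /allP BM]]].
    rewrite /bl -map_flatten => /mapP[h hB vh] /eqP n'n; subst n'.
    move: (hB); rewrite /= flattenB => /mapP[g gKF hg].
    apply/allpairsP; exists (g, a); split => //=; first by rewrite !inE; case: (a).
    by rewrite vh tK ?BM // hg mulKg to.
  apply: leq_trans (card_size _) _.
  by rewrite size_allpairs size_flatten_translates leq_mul // leq_mul.
have [c cE] := avoiding_coloring (fun i : I => i.2)
  bl_uniq bl_gt0 bl_size al01 r0 qr sum_bl.
exists (c \o t) => n a x nM xM BM.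
have := cE (Ordinal nM, t x, a); rewrite /E /bl /= tK // eqxx => /(_ BM).
rewrite has_map => /hasP[D DB /= /allP Da]; apply/hasP; exists D => //.
by apply/allP => g gD; apply: Da; apply: map_f.
Qed.

(** The color of [g] in the limit is the one that [C M] gives it for [U]-almost all [M], where the
    ultrafilter [U] contains all tails. Finitely many such agreements and a tail have a common
    [M]. *)
Lemma compact_coloring (C : nat -> G -> bool) : exists c : G -> bool,
  forall (s : seq G) m, exists2 M, (m <= M)%N & {in s, C M =1 c}.
Proof.
have [U [UU sU]] := ultraFilterLemma eventually_filter.
pose c g := `[< U [set M | C M g]%classic >].
have Uc g : U [set M | C M g = c g]%classic.
  rewrite /c; case: (asboolP (U _)) => [Ug|nUg]; first exact: Ug.
  have [//|] := in_ultra_setVsetC [set M | C M g]%classic UU.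
  by apply: filterS => M /= /negP/negbTE.
exists c => s m.
have Us : U [set M | {in s, C M =1 c}]%classic.
  elim: s => [|g s IH]; first by apply: filterS filterT => M _ g; rewrite inE.
  apply: filterS (filterI (Uc g) IH) => M [/= Mg Ms] h.
  by rewrite inE => /orP[/eqP -> //|]; exact: Ms.
have Um : U [set M | m <= M]%classic%N by apply: sU; exists m.
by have [M [/= sM mM]] := filter_ex (filterI Us Um); exists M.
Qed.

Lemma syndetic_mono_coloring (k : nat) (K : nat -> seq G) (e : G -> nat)
    (d : nat -> G) :
  cancel e d -> (0 < k)%N -> (forall n, size (K n) <= k)%N ->
  (forall n, uniq (K n)) ->
  exists c : G -> bool, forall n, exists F : seq G, forall a x,
    exists2 f, f \in F & {in K n, forall h, c (h * f * x)%g = a}.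
Proof.
move=> eK k0 Kk uK.
have [al [r [al01 /andP[r0 r1] qr]]] := local_lemma_constants k0.
have [al0 al1] := andP al01.
(* The sets [F n] are fixed before any stage [M], so they remain valid for the limit coloring. *)
have /choice[F FP] n : exists F : seq G, [/\ (0 < size F)%N,
    uniq (flatten (translates (K n) F)) &
    (size F * k * 2)%:R * r ^+ size F <= (1 - al) * 2 ^- n.+1].
  have eps0 : 0 < (1 - al) * 2 ^- n.+1 / (k * 2)%:R.
    by rewrite divr_gt0 ?ltr0n ?muln_gt0 ?k0 // mulr_gt0 ?subr_gt0 ?invr_gt0 ?exprn_gt0.
  have [|N N0 Nr] := @mulrn_expr_small r _ _ eps0; first by rewrite r0.
  have [F FN uF] := disjoint_translates N (uK n).
  exists F; rewrite FN; split => //; move: Nr.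
  by rewrite ler_pdivlMr ?ltr0n ?muln_gt0 ?k0 // mulrAC -natrM mulnA.
have al01' : 0 < al <= 1 by rewrite al0 ltW.
have stage M := finite_stage_coloring M eK al01' r0 qr Kk
  (fun n => let: And3 h _ _ := FP n in h)
  (fun n => let: And3 _ h _ := FP n in h)
  (fun n => let: And3 _ _ h := FP n in h).
have [C CP] := choice stage.
have [c cC] := compact_coloring C.
exists c => n; exists (F n) => a x.
pose s := flatten (shifted_translates (K n) (F n) x).
(* The sum bounds the number of every point of [s], so the constraint for [n] and [x] is already
   active at stage [M]. *)
have [M mM CMc] := cC s (n.+1 + e x + \sum_(g <- s) e g)%N.
have nM : (n < M)%N by apply: leq_trans mM; rewrite -addnA leq_addr.
have xM : (e x <= M)%N by apply: leq_trans mM; rewrite addnAC leq_addl.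
have sM : all (fun g => e g <= M)%N s.
  apply/allP => g gs; apply: leq_trans mM.
  by rewrite (big_rem g) //= addnCA leq_addr.
have /hasP[D DB Da] := CP M n a x nM xM sM.
move: (DB) => /mapP[_ /mapP[f fF ->] DE]; exists f => // h hK.
have hD : (h * f * x)%g \in D by rewrite DE; apply/map_f/map_f.
rewrite -CMc; first exact/eqP/(allP Da).
by apply/flattenP; exists D.
Qed.
End Group.

(** * From the coloring to the two meager sets *)

Local Open Scope classical_set_scope.

(** Apply the hypothesis to the inverses of [K]: if all [f * x] with [f] in [F] were of the form
    [h * b] with [h] in [K] and [b] of color [a], then for each [f] some [h^-1 * f * x] would have
    color [a], against the choice of [F]. *)
Lemma meager_color_class (G : groupType) (k : nat) (c : G -> bool) (a : bool) :
  (forall s : seq G, uniq s -> (size s <= k)%N -> exists F : seq G, forall x,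
     exists2 f, f \in F & {in s, forall h, c (h * f * x)%g = ~~ a}) ->
  meager k [set g | c g = a].
Proof.
move=> mono K Kk; have finK : finite_set K by apply/finite_set_leP; exists k.
pose s := [seq h^-1%g | h <- finmap.enum_fset (fset_set K)].
have [||F Fs] := mono s.
- by rewrite map_inj_uniq ?finmap.fset_uniq //; exact: invg_inj.
- by rewrite size_map; exact: geq_card_fset_set.
case/(_ [set` F] (finite_seq F)) => x Fx; have [f fF cf] := Fs x.
have [|h Kh [b cb hb]] := Fx (f * x)%g; first by exists f => //; exists x.
have hs : (h^-1)%g \in s.
  by apply: map_f; rewrite in_fset_set // inE.
have := cf _ hs; rewrite -mulgA -hb mulKg cb.
by case: (a).
Qed.

Theorem theorem6p1 (G : groupType)
  (countableG : countable [set: G]) (infiniteG : infinite_set [set: G])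
  (k : nat) (k_gt0 : (0 < k)%N) :
  exists A B : set G,
    [/\ A `|` B = [set: G], A `&` B = set0, meager k A & meager k B].
Proof.
have /countable_injP[e e_inj] := countableG.
pose d n : G := xget 1%g [set g | e g = n].
have eK : cancel e d.
  by move=> g; apply: e_inj; rewrite ?inE //; exact: (@xgetI _ _ [set h | e h = e g] g).
(* Enumerates all duplicate-free lists of length at most [k] through codes of lists of numbers;
   every other code yields the empty list, which satisfies the same bounds. *)
pose K n : seq G := let s := map d (odflt [::] (unpickle n)) in
  if uniq s && (size s <= k)%N then s else [::].
have Kk n : (size (K n) <= k)%N by rewrite /K; case: ifP => // /andP[].
have uK n : uniq (K n) by rewrite /K; case: ifP => // /andP[].
have K_surj s : uniq s -> (size s <= k)%N -> exists n, K n = s.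
  move=> us sk; exists (pickle (map e s)).
  by rewrite /K pickleK /= (mapK eK) us sk.
have [c cP] := syndetic_mono_coloring infiniteG eK k_gt0 Kk uK.
have mono a s : uniq s -> (size s <= k)%N -> exists F : seq G, forall x,
    exists2 f, f \in F & {in s, forall h, c (h * f * x)%g = ~~ a}.
  move=> us sk; have [n <-] := K_surj s us sk.
  by have [F FP] := cP n; exists F => x; exact: FP.
exists [set g | c g = true], [set g | c g = false]; split.
- by apply/seteqP; split => // g _ /=; case: (c g); [left|right].
- by apply/seteqP; split => // g /= [->].
- exact/meager_color_class/(mono true).
- exact/meager_color_class/(mono false).
Qed.
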